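(* Let $\varphi\in\Phi$ with right derivative $\psi^+$ and let $f\in L^{\psi^+}_{loc}(\mathbb{R}^n)$. Suppose that $\psi^+$ is a strictly increasing function and that $f\in t_m^{\psi^+}(x)$ at a fixed point $x\in\mathbb{R}^n$. For $\varepsilon>0$ let $P_x^\varepsilon(f)$ be the extended best approximation polynomial of $f$ on $B(x,\varepsilon)$, i.e. the element of $\mu_{\psi^+}^{\varepsilon,x}(f)$, and let $P_x(f)$ be the polynomial of degree at most $m$ appearing in the definition of $f\in t_m^{\psi^+}(x)$. Then $P_x^\varepsilon(f)(t)\to P_x(f)(t)$ as $\varepsilon\to0$ for every $t\in\mathbb{R}^n$.
   Context: $\mathcal S$ is the set of non-decreasing functions $\psi:[0,\infty)\to[0,\infty)$ with $\psi(0)=0$, $\psi(s)>0$ for $s>0$, $\psi(s)\to0$ as $s\to0^+$ and $\psi(s)\to\infty$ as $s\to\infty$. A function $\psi$ satisfies the $\Delta_2$ condition if there is a constant $\Lambda_\psi>0$ with $\psi(2s)\leqslant\Lambda_\psi\psi(s)$ for all $s\ge0$. $\Phi$ is the class of functions $\varphi(s)=\int_0^s\psi(r)\,dr$ on $[0,\infty)$, with $\psi\in\mathcal S$, that satisfy the $\Delta_2$ condition. $\psi^-,\psi^+$ denote the left and right derivatives of $\varphi$, with $\psi^-(0)=\psi^+(0)=0$. $\Pi^m$ is the space of real algebraic polynomials on $\mathbb{R}^n$ of degree at most $m$. $B(x,\varepsilon)$ is the ball in $\mathbb{R}^n$ centered at $x$ with radius $\varepsilon>0$. $L^{\psi^+}_{loc}(\mathbb{R}^n)$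 is the class of measurable real functions $f$ on $\mathbb{R}^n$ with $\psi^+(|f|)$ integrable on bounded sets. For $B=B(x,\varepsilon)$, $\mu_{\psi^+}^{\varepsilon,x}(f)$ is the set of extended best approximation polynomials of $f$ on $B$: all $P\in\Pi^m$ such that for all $Q\in\Pi^m$ $$\int_{B\cap\{f>P\}\cap\{Q>0\}}\psi^-(|f-P|)|Q|\,dt+\int_{B\cap\{f<P\}\cap\{Q<0\}}\psi^-(|f-P|)|Q|\,dt\leqslant\int_{B\cap\{f<P\}\cap\{Q>0\}}\psi^+(|f-P|)|Q|\,dt+\int_{B\cap\{f>P\}\cap\{Q<0\}}\psi^+(|f-P|)|Q|\,dt .$$ When $\psi^+$ is strictly increasing this set has exactly one element. For $f\in L^{\psi^+}_{loc}(\mathbb{R}^n)$, one says $f\in t_m^{\psi^+}(x)$ if there exists a polynomial $P_x(f)(t)$ of degree at most $m$ such that $$\frac1{|B(x,\varepsilon)|}\int_{B(x,\varepsilon)}\psi^+(|f(t)-P_x(f)(t)|)\,dt=o(\psi^+(\varepsilon^m))\quad\text{as }\varepsilon\to0 ;$$ such a polynomial is unique. *)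

(* Defs.v *)
From HB Require Import structures.
From mathcomp Require Import all_boot all_order all_algebra.
From mathcomp Require Import all_classical all_reals all_analysis.
From mathcomp Require mpoly.
Import (canonicals, coercions) mpoly.

Set Implicit Arguments.
Unset Strict Implicit.
Unset Printing Implicit Defensive.
Import Order.TTheory GRing.Theory Num.Theory.
Import numFieldNormedType.Exports.
Local Open Scope classical_set_scope.
Local Open Scope ring_scope.

Section product_lebesgue.
Context {R : realType}.
Local Notation borelR := (measurableTypeR R).

Definition cons_pt n (p : borelR * n.-tuple borelR) : n.+1.-tuple borelR :=
  [the n.+1.-tuple borelR of p.1 :: p.2].

Lemma measurable_cons_pt n : measurable_fun [set: _] (@cons_pt n).
Proof. by apply: measurable_cons. Qed.

Section succ.
Variables (n : nat) (mu : {sigma_finite_measure set (n.-tuple borelR) -> \bar R}).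

Definition cons_lebesgue : set (n.+1.-tuple borelR) -> \bar R :=
  pushforward (@lebesgue_measure R \x mu)%E (@cons_pt n).

Let cons0 : cons_lebesgue set0 = 0%E.
Proof. by rewrite /cons_lebesgue /pushforward preimage_set0 measure0. Qed.

Let cons_ge0 A : (0 <= cons_lebesgue A)%E.
Proof. by rewrite /cons_lebesgue /pushforward measure_ge0. Qed.

Let cons_sigma_additive : semi_sigma_additive cons_lebesgue.
Proof.
move=> F mF tF mUF; rewrite /cons_lebesgue /pushforward preimage_bigcup.
apply: measure_semi_sigma_additive.
- by move=> k; rewrite -[X in measurable X]setTI; exact: measurable_cons_pt.
- apply/trivIsetP => /= i j _ _ ij; rewrite -preimage_setI.
  by move/trivIsetP : tF => /(_ _ _ _ _ ij) ->//; rewrite preimage_set0.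
- by rewrite -preimage_bigcup -[X in measurable X]setTI; exact: measurable_cons_pt.
Qed.

HB.instance Definition _ := isMeasure.Build _ _ _ cons_lebesgue
  cons0 cons_ge0 cons_sigma_additive.

Let cons_sigma_finite : sigma_finite setT cons_lebesgue.
Proof.
have /sigma_finiteP[F [FT ndF Foo]] := sigma_finiteT (@lebesgue_measure R).
have /sigma_finiteP[G [GT ndG Goo]] := sigma_finiteT mu.
pose uncons (t : n.+1.-tuple borelR) : borelR * n.-tuple borelR :=
  (thead t, [tuple of behead t]).
have mu_uncons : measurable_fun [set: _] uncons.
  apply/measurable_fun_pairP; split.
    exact: measurable_tnth.
  exact: measurable_behead.
have consK : cancel (@cons_pt n) uncons.
  by case=> a t; congr pair; apply/val_inj.
exists (fun k => uncons @^-1` (F k `*` G k)).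
  rewrite -preimage_bigcup; apply/esym/seteqP; split => // t _ /=.
  have [i _ Fi] : (\bigcup_i F i) (uncons t).1 by rewrite -FT.
  have [j _ Gj] : (\bigcup_j G j) (uncons t).2 by rewrite -GT.
  exists (maxn i j) => //; split.
    by move: Fi; exact/subsetPset/ndF/leq_maxl.
  by move: Gj; exact/subsetPset/ndG/leq_maxr.
move=> k; have [? ?] := Foo k; have [? ?] := Goo k; split.
  by rewrite -[X in measurable X]setTI; apply: mu_uncons => //; exact: measurableX.
rewrite /cons_lebesgue /pushforward -comp_preimage.
rewrite (_ : uncons \o _ = id) ?preimage_id; last exact/funext/consK.
by rewrite product_measure1E// lte_mul_pinfty// ge0_fin_numE.
Qed.

HB.instance Definition _ :=
  Measure_isSigmaFinite.Build _ _ _ cons_lebesgue cons_sigma_finite.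
End succ.

Fixpoint product_lebesgue n :
    {sigma_finite_measure set (n.-tuple borelR) -> \bar R} :=
  if n is n'.+1 return {sigma_finite_measure set (n.-tuple borelR) -> \bar R}
  then cons_lebesgue (product_lebesgue n')
  else \d_([tuple] : 0.-tuple borelR).

Let measurable_box n (A : 'I_n -> set borelR) : (forall i, measurable (A i)) ->
  measurable [set t : n.-tuple borelR | forall i, A i (tnth t i)].
Proof.
move=> mA.
have -> : [set t : n.-tuple borelR | forall i, A i (tnth t i)] =
    \bigcap_(i in [set: 'I_n]) ((@tnth n _ ^~ i) @^-1` A i).
  by apply/seteqP; split => t /= H i; [move=> _|]; exact: H.
apply: fin_bigcap_measurable => [|i _]; first exact: finite_finset.
by rewrite -[X in measurable X]setTI; exact: measurable_tnth.
Qed.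

Lemma product_lebesgue_box n (A : 'I_n -> set borelR) :
  (forall i, measurable (A i)) ->
  (product_lebesgue n [set t | forall i, A i (tnth t i)] =
   \prod_(i < n) lebesgue_measure (A i))%E.
Proof.
elim: n A => [|n IH] A mA.
  by rewrite big_ord0 /= diracE mem_set//= => -[].
rewrite big_ord_recl /= /cons_lebesgue /pushforward.
have -> : @cons_pt n @^-1` [set t | forall i, A i (tnth t i)] =
    A ord0 `*` [set t | forall i, A (lift ord0 i) (tnth t i)].
  apply/seteqP; split => -[a t] /=.
    move=> H; split; first by have := H ord0.
    by move=> i; have := H (lift ord0 i); rewrite /cons_pt tnthS.
  move=> [H0 H] i; case: (unliftP ord0 i) => [j|] ->; last by [].
  by rewrite /cons_pt tnthS; exact: H.
have mB := @measurable_box n (fun i => A (lift ord0 i)) (fun i => mA _).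
rewrite product_measure1E//; congr (_ * _)%E.
by rewrite -(IH (fun i => A (lift ord0 i)) (fun i => mA _)).
Qed.

End product_lebesgue.

(** [Rn R n] carries the sigma-algebra of Lebesgue measurable sets: it is the
    Caratheodory completion of the n-fold product Borel measure. *)
Section Rn.
Variables (R : realType) (n : nat).

Definition Rn : Type :=
  caratheodory_type (mu_ext (product_lebesgue n : set _ -> \bar R)).

HB.instance Definition _ := Measurable.copy Rn
  (caratheodory_type (mu_ext (product_lebesgue n : set _ -> \bar R))).

Definition lebesgue_Rn : set Rn -> \bar R :=
  @completed_measure_extension _ (n.-tuple (measurableTypeR R)) R
    (product_lebesgue n).

HB.instance Definition _ := Measure.on lebesgue_Rn.

Lemma lebesgue_Rn_borel (A : set (n.-tuple (measurableTypeR R))) :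
  measurable A ->
  measurable (A : set Rn) /\ lebesgue_Rn (A : set Rn) = product_lebesgue n A.
Proof.
move=> mA; split; first exact: (@caratheodory_measurable_mu_ext _ _ _ (product_lebesgue n) _ mA).
exact: (@measurable_mu_extE _ _ _ (product_lebesgue n) _ mA).
Qed.

Definition coord (t : Rn) (i : 'I_n) : R := tnth t i.

Definition eball (x : Rn) (e : R) : set Rn :=
  [set t | Num.sqrt (\sum_(i < n) (coord t i - coord x i) ^+ 2) < e].

Definition ebounded (A : set Rn) := exists x r, A `<=` eball x r.

Definition peval (P : mpoly.mpoly n R) (t : Rn) : R := mpoly.meval (coord t) P.

(** [mpoly.mmeasure mpoly.mdeg P] is the [msize] of multinomials, i.e. one plus
    the total degree of [P], or zero when [P] is the zero polynomial. *)
Definition poly_space (m : nat) : set (mpoly.mpoly n R) :=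
  [set P | (mpoly.mmeasure mpoly.mdeg P <= m.+1)%N].

End Rn.

(** Functions on [0, oo) are represented by total functions on R whose values on
    negative numbers are irrelevant. *)
Section Phi_class.
Context {R : realType}.
Implicit Types psi phi : R -> R.

Definition class_S : set (R -> R) := [set psi : R -> R |
  [/\ {in `[0, +oo[ &, {homo psi : r s / r <= s}},
      psi 0 = 0,
      forall s : R, 0 < s -> 0 < psi s,
      psi s @[s --> 0^'+] --> 0 &
      psi s @[s --> +oo] --> +oo]].

Definition Delta2 phi :=
  exists2 L : R, 0 < L & forall s : R, 0 <= s -> phi (2 * s) <= L * phi s.

Definition class_Phi : set (R -> R) := [set phi : R -> R |
  (exists2 psi, class_S psi &
     forall s : R, 0 <= s -> phi s = \int[lebesgue_measure]_(r in `[0, s]) psi r)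
  /\ Delta2 phi].

(** Left and right derivatives of [phi] on ]0, oo[, extended by 0 elsewhere. *)
Definition rderiv phi (s : R) : R :=
  if 0 < s then lim (h^-1 * (phi (s + h) - phi s) @[h --> 0^'+]) else 0.

Definition lderiv phi (s : R) : R :=
  if 0 < s then lim (h^-1 * (phi (s + h) - phi s) @[h --> 0^'-]) else 0.

End Phi_class.

Section approximation.
Context {R : realType} {n : nat}.
Local Notation mu := (@lebesgue_Rn R n).
Implicit Types (phi psi : R -> R) (f : Rn R n -> R) (P : mpoly.mpoly n R).

Definition L_loc psi : set (Rn R n -> R) := [set f : Rn R n -> R |
  measurable_fun [set: Rn R n] f /\
  forall A : set (Rn R n), measurable A -> ebounded A ->
    mu.-integrable A (fun t => (psi `|f t|)%:E)].

Definition ext_best_approx phi (m : nat) f (x : Rn R n) (e : R) :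
    set (mpoly.mpoly n R) := [set P | poly_space m P /\
  forall Q : mpoly.mpoly n R, poly_space m Q ->
  let B := eball x e in
  let f_gt_P := [set t | peval P t < f t] in
  let f_lt_P := [set t | f t < peval P t] in
  let Q_pos := [set t | 0 < peval Q t] in
  let Q_neg := [set t | peval Q t < 0] in
  let wl t := lderiv phi `|f t - peval P t| * `|peval Q t| in
  let wr t := rderiv phi `|f t - peval P t| * `|peval Q t| in
  (\int[mu]_(t in B `&` f_gt_P `&` Q_pos) (wl t)%:E
   + \int[mu]_(t in B `&` f_lt_P `&` Q_neg) (wl t)%:E
   <= \int[mu]_(t in B `&` f_lt_P `&` Q_pos) (wr t)%:E
   + \int[mu]_(t in B `&` f_gt_P `&` Q_neg) (wr t)%:E)%E].

(** The integral below is real-valued; it is finite when [f] is in [L_loc psi]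
    and [psi] is the right derivative of a function in [class_Phi], since
    [psi] then inherits the [Delta2] condition. *)
Definition taylor_witness psi (m : nat) f (x : Rn R n) P :=
  poly_space m P /\
  (fun e : R => (fine (mu (eball x e)))^-1 *
     \int[mu]_(t in eball x e) psi `|f t - peval P t|)
  =o_ (0^'+) (fun e : R => psi (e ^+ m)).

Definition t_class psi (m : nat) (x : Rn R n) : set (Rn R n -> R) :=
  [set f : Rn R n -> R | L_loc psi f /\ exists P, taylor_witness psi m f x P].

End approximation.

(* Main.v *)
Require Import Defs.
From mathcomp Require Import all_boot all_order all_algebra.
From mathcomp Require Import all_classical all_reals all_analysis.
From mathcomp Require Import measurable_realfun zify lra ring.
From mathcomp Require mpoly.
Import (canonicals, coercions) mpoly.

Set Implicit Arguments.
Unset Strict Implicit.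
Unset Printing Implicit Defensive.
Import Order.TTheory GRing.Theory Num.Theory.
Import numFieldNormedType.Exports.
Local Open Scope classical_set_scope.
Local Open Scope ring_scope.

(** Write [Q = Px - Pe], [B] for the ball of radius [e], and [psi^+], [psi^-]
    for the one-sided derivatives of [phi].  Testing the best approximation
    inequality with [Q] and using the doubling condition in the form
    [psi^+(2s) <= C psi^-(s)] gives
    [int_B psi^+(|Q|) |Q| <= 2C int_B psi^+(|f - Px|) |Q|].
    A polynomial is comparable to its supremum [M] over an inscribed cube on a
    subcube of proportional measure, so [psi^+(M/4)] is at most a constant times
    the mean of [psi^+(|f - Px|)] over [B], which is [o(psi^+(e^m))].  By
    doubling again, [M = o(e^m)], and a polynomial of degree at most [m] that
    is [o(e^m)] on cubes of side comparable to [e] tends to 0 at every point.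
    All bounds on polynomials are obtained by restriction to lines. *)

(* [coord] is shadowed by the coordinate function of the vector library. *)
Local Notation coord := Defs.coord.

(** * Primitives of nondecreasing functions and their difference quotients *)

Section one_sided_derivatives.
Context {R : realType}.
Variables psi phi : R -> R.
Hypothesis psi_nd : {in `[0, +oo[ &, {homo psi : r s / r <= s}}.
Hypothesis phiE : forall s : R, 0 <= s ->
  phi s = \int[lebesgue_measure]_(r in `[0, s]) psi r.

Let psi_homo (a b : R) : 0 <= a -> a <= b -> psi a <= psi b.
Proof.
by move=> a0 ab; apply: psi_nd; rewrite ?in_itv/= ?andbT// (le_trans a0).
Qed.

Let psi_integrable (a b : R) : 0 <= a ->
  lebesgue_measure.-integrable `[a, b] (EFin \o psi).
Proof.
move=> a0; apply: measurable_bounded_integrable => //.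
- by rewrite /= lebesgue_measure_itv/=; case: ifP => _; rewrite ltry.
(* Values of [psi] at negative arguments are arbitrary; composing with [Num.max 0] gives a function
   monotone on the whole line that agrees with [psi] on [[a, b]]. *)
- apply: (@eq_measurable_fun _ _ _ _ _ (psi \o Num.max 0)).
    move=> r; rewrite inE/= in_itv/= => /andP[ar _].
    by rewrite max_r// (le_trans a0).
  apply: nondecreasing_measurable => // r s rs /=; apply: psi_homo.
    by rewrite le_max lexx.
  by rewrite ge_max le_max lexx/= le_max rs orbT.
- exists (Num.max `|psi a| `|psi b|); split; first exact: num_real.
  move=> M MM r /=; rewrite in_itv/= => /andP[ar rb].
  apply/ltW/(le_lt_trans _ MM).
  have h1 := psi_homo a0 ar; have h2 := psi_homo (le_trans a0 ar) rb.
  rewrite le_max; apply/orP; have [p0|p0] := leP 0 (psi r).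
    by right; rewrite !ger0_norm// (le_trans p0).
  by left; rewrite !ltr0_norm ?lerN2// (le_lt_trans h1).
Qed.

(** On [[a, b]] the monotone integrand lies between its end values. All bounds on difference
    quotients below derive from this. *)
Lemma phi_increment (a b : R) : 0 <= a -> a <= b ->
  (b - a) * psi a <= phi b - phi a <= (b - a) * psi b.
Proof.
move=> a0 ab.
have [->|neq_ab] := eqVneq a b; first by rewrite !subrr !mul0r lexx.
have ltab : a < b by rewrite lt_neqAle neq_ab.
have b0 : 0 <= b := le_trans a0 ab.
rewrite !phiE// Rintegral_itvB ?bnd_simp ?psi_integrable//.
rewrite Rintegral_itv_obnd_cbnd; last first.
  apply: integrableS (psi_integrable b a0) => //.
  by apply: subset_itvr; rewrite bnd_simp.
have cstE c : (b - a) * c = \int[lebesgue_measure]_(r in `[a, b]) c.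
  by rewrite Rintegral_cst//= lebesgue_measure_itv/= lte_fin ltab mulrC.
have cst_int c : lebesgue_measure.-integrable `[a, b] (EFin \o (fun=> c : R)).
  apply: measurable_bounded_integrable => //.
    by rewrite /= lebesgue_measure_itv/=; case: ifP => _; rewrite ltry.
  by exists `|c|; split => [|M cM r _ /=]; [exact: num_real|exact/ltW].
by rewrite !cstE; apply/andP; split; apply: le_Rintegral => //;
   rewrite ?psi_integrable// => r; rewrite /= in_itv/= => /andP[ar rb];
   apply: psi_homo => //; apply: le_trans ar.
Qed.

(** Convexity: [psi (s + h)] bounds the slope over [[s, s + h]] from above and the slope over
    [[s + h, s + k]] from below, and the slope over [[s, s + k]] is a weighted mean of the two. *)
Lemma right_quotient_homo (s h k : R) : 0 <= s -> 0 < h -> h <= k ->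
  h^-1 * (phi (s + h) - phi s) <= k^-1 * (phi (s + k) - phi s).
Proof.
move=> s0 h0 hk; have k0 : 0 < k by apply: lt_le_trans hk.
have sh0 : 0 <= s + h by lra.
have shk : s + h <= s + k by lra.
have ssh : s <= s + h by lra.
have /andP[_] := phi_increment s0 ssh.
have /andP[+ _] := phi_increment sh0 shk.
rewrite ler_pdivrMl// mulrCA ler_pdivlMl//; nra.
Qed.

(** The same argument with [psi (s + k)] as separating value; [- s <= h] keeps [s + h] in the range
    where [phi] is the given integral. *)
Lemma left_quotient_homo (s h k : R) : - s <= h -> h <= k -> k < 0 ->
  h^-1 * (phi (s + h) - phi s) <= k^-1 * (phi (s + k) - phi s).
Proof.
move=> sh hk k0; have h0 : h < 0 by apply: le_lt_trans k0.
have sh0 : 0 <= s + h by lra.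
have shk : s + h <= s + k by lra.
have sk0 : 0 <= s + k by lra.
have sks : s + k <= s by lra.
have /andP[+ _] := phi_increment sk0 sks.
have /andP[_] := phi_increment sh0 shk.
rewrite ler_ndivrMl// mulrCA ler_ndivrMl//; nra.
Qed.

Lemma rderiv_bounds (s u : R) : 0 < s -> s < u -> psi s <= rderiv phi s <= psi u.
Proof.
move=> s0 su; rewrite /rderiv s0.
have D_ge h : 0 < h -> psi s <= h^-1 * (phi (s + h) - phi s).
  move=> h0; have ssh : s <= s + h by lra.
  have /andP[+ _] := phi_increment (ltW s0) ssh.
  by rewrite ler_pdivlMl// addrAC subrr add0r.
(* [lim] is a total operator, so bounds on it require convergence first: the quotient is monotone in
   [h] and bounded below. *)
have cvgD : cvg (h^-1 * (phi (s + h) - phi s) @[h --> 0^'+]).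
  apply: nondecreasing_at_right_is_cvgr; near=> x.
    move=> h k; rewrite !in_itv/= => /andP[h0 _] _ hk.
    exact: right_quotient_homo (ltW s0) h0 hk.
  by exists (psi s) => y [h /=]; rewrite in_itv/= => /andP[h0 _] <-; exact: D_ge.
apply/andP; split.
  apply: limr_ge => //; near=> h; apply: D_ge; near: h; exact: nbhs_right_gt.
apply: limr_le => //; near=> h.
have h0 : 0 < h by near: h; exact: nbhs_right_gt.
have hsu : h < u - s by near: h; apply: nbhs_right_lt; rewrite subr_gt0.
have ssh : s <= s + h by lra.
rewrite ler_pdivrMl//; have /andP[_] := phi_increment (ltW s0) ssh.
rewrite addrAC subrr add0r => /le_trans; apply.
by rewrite ler_pM2l// psi_homo//; lra.
Unshelve. all: by end_near. Qed.

Lemma lderiv_bounds (s u : R) : 0 < s -> 0 <= u < s ->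
  [/\ psi u <= lderiv phi s, lderiv phi s <= psi s &
      (phi s - phi 0) / s <= lderiv phi s].
Proof.
move=> s0 /andP[u0 us]; rewrite /lderiv s0.
have D_le h : - s < h -> h < 0 -> h^-1 * (phi (s + h) - phi s) <= psi s.
  move=> sh h0; have sh0 : 0 <= s + h by lra.
  have ssh : s + h <= s by lra.
  by have /andP[_] := phi_increment sh0 ssh; rewrite ler_ndivrMl//; lra.
have cvgD : cvg (h^-1 * (phi (s + h) - phi s) @[h --> 0^'-]).
  apply: nondecreasing_at_left_is_cvgr; near=> x.
    move=> h k; rewrite !in_itv/= => /andP[xh _] /andP[_ k0] hk.
    apply: left_quotient_homo => //; apply/ltW/(le_lt_trans _ xh)/ltW.
    by near: x; apply: nbhs_left_gt; rewrite oppr_lt0.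
  exists (psi s) => y [h /=]; rewrite in_itv/= => /andP[xh h0] <-.
  apply: D_le => //; apply: lt_trans xh.
  by near: x; apply: nbhs_left_gt; rewrite oppr_lt0.
split.
- apply: limr_ge => //; near=> h.
  have h0 : h < 0 by near: h; exact: nbhs_left_lt.
  have hsu : u - s < h by near: h; apply: nbhs_left_gt; rewrite subr_lt0.
  have sh0 : 0 <= s + h by lra.
  have ssh : s + h <= s by lra.
  have ush : u <= s + h by lra.
  have := psi_homo u0 ush.
  have /andP[+ _] := phi_increment sh0 ssh.
  by rewrite ler_ndivlMl//; nra.
- apply: limr_le => //; near=> h.
  apply: D_le; near: h; last exact: nbhs_left_lt.
  by apply: nbhs_left_gt; rewrite oppr_lt0.
(* The chord from 0 to [s] is the quotient at the increment [- s], the smallest of the quotients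
   that increase to the left derivative. *)
- apply: limr_ge => //; near=> h.
  have h0 : h < 0 by near: h; exact: nbhs_left_lt.
  have sh : - s <= h by near: h; apply: nbhs_left_ge; rewrite oppr_lt0.
  have := left_quotient_homo (lexx _) sh h0; rewrite subrr invrN; lra.
Unshelve. all: by end_near. Qed.

End one_sided_derivatives.

(** * Monotonicity and doubling of the one-sided derivatives *)

Section Phi_derivatives.
Context {R : realType}.
Implicit Types phi : R -> R.

Let zero_lt (s : R) : 0 < s -> 0 <= (0 : R) < s.
Proof. by rewrite lexx. Qed.

(** For [0 < r < s] the value [psi r] separates the two derivatives. The default 0 at nonpositive
    arguments extends monotonicity to all of [R], which later yields measurability of
    compositions. *)
Lemma lderiv_homo phi : class_Phi phi -> {homo lderiv phi : r s / r <= s}.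
Proof.
move=> [[psi [nd p0 pgt _ _] phiE] _] r s; rewrite le_eqVlt => /predU1P[->//|rs].
have [r0|r0] := ltP 0 r; last first.
  rewrite {1}/lderiv ltNge r0/=; have [s0|s0] := ltP 0 s.
    by rewrite -p0; have [] := @lderiv_bounds _ _ _ nd phiE s 0 s0; rewrite ?lexx.
  by rewrite /lderiv ltNge s0.
have s0 : 0 < s by apply: lt_trans rs.
have [_ + _] := @lderiv_bounds _ _ _ nd phiE r 0 r0 (zero_lt r0).
move=> /le_trans; apply.
by have [] := @lderiv_bounds _ _ _ nd phiE s r s0; rewrite ?(ltW r0).
Qed.

Lemma lderiv_ge0 phi s : class_Phi phi -> 0 <= lderiv phi s.
Proof.
move=> Phi; have [s0|s0] := leP 0 s; last by rewrite /lderiv ltNge (ltW s0).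
by rewrite (le_trans _ (lderiv_homo Phi s0))// /lderiv ltxx.
Qed.

Lemma lderiv_le_rderiv phi s : class_Phi phi -> lderiv phi s <= rderiv phi s.
Proof.
move=> [[psi [nd p0 pgt _ _] phiE] _].
have [s0|s0] := ltP 0 s; last by rewrite /lderiv /rderiv ltNge s0.
have [_ + _] := @lderiv_bounds _ _ _ nd phiE s 0 s0 (zero_lt s0).
move=> /le_trans; apply.
have ss1 : s < s + 1 by rewrite ltrDl.
by have /andP[] := @rderiv_bounds _ _ _ nd phiE s (s + 1) s0 ss1.
Qed.

Lemma rderiv_gt0 phi s : class_Phi phi -> 0 < s -> 0 < rderiv phi s.
Proof.
move=> [[psi [nd _ pgt _ _] phiE] _] s0; have ss1 : s < s + 1 by rewrite ltrDl.
have /andP[+ _] := @rderiv_bounds _ _ _ nd phiE s (s + 1) s0 ss1.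
exact/lt_le_trans/pgt.
Qed.

Lemma rderiv_ge0 phi s : class_Phi phi -> 0 <= rderiv phi s.
Proof.
by move=> Phi; rewrite (le_trans (lderiv_ge0 s Phi))// lderiv_le_rderiv.
Qed.

Lemma rderiv_homo phi : class_Phi phi -> {homo rderiv phi : r s / r <= s}.
Proof.
move=> Phi r s; rewrite le_eqVlt => /predU1P[->//|rs].
have [r0|r0] := ltP 0 r; last first.
  by rewrite {1}/rderiv ltNge r0/= rderiv_ge0.
have [[psi [nd _ _ _ _] phiE] _] := Phi.
have s0 : 0 < s by apply: lt_trans rs.
have ss1 : s < s + 1 by rewrite ltrDl.
have /andP[_ +] := @rderiv_bounds _ _ _ nd phiE r s r0 rs.
have /andP[+ _] := @rderiv_bounds _ _ _ nd phiE s (s + 1) s0 ss1.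
by move=> /[swap]; exact: le_trans.
Qed.

(* With [psi] the integrand of [phi] and [L] its doubling constant,
   [s psi^+(2s) <= s psi(3s) <= phi(4s) <= L^2 phi(s) <= L^2 s psi^-(s)]. *)
Lemma rderiv_doubling phi : class_Phi phi ->
  exists2 C : R, 1 <= C &
    forall s, 0 <= s -> rderiv phi (2 * s) <= C * lderiv phi s.
Proof.
move=> Phi; have [[psi [nd p0 pgt _ _] phiE] [L L0 HL]] := Phi.
(* The summand 1 ensures [1 <= C], so that multiplying a nonnegative term by [C] does not decrease
   it. *)
exists (1 + L * L) => [|s]; first by rewrite lerDl mulr_ge0// ltW.
rewrite le_eqVlt => /predU1P[<-|s0].
  by rewrite mulr0 /rderiv /lderiv ltxx mulr0.
have phi0 : phi 0 = 0 by rewrite phiE// set_itv1 Rintegral_set1.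
(* [rderiv_bounds] asks for a point strictly above [2 * s]; [3 * s] still leaves an interval of
   length [s] up to [4 * s]. *)
have [s20 s23 s30 s34] :
    [/\ 0 < 2 * s, 2 * s < 3 * s, 0 <= 3 * s & 3 * s <= 4 * s].
  by split; lra.
have /andP[_ h1] := @rderiv_bounds _ _ _ nd phiE _ _ s20 s23.
have /andP[h2 _] := @phi_increment _ _ _ nd phiE _ _ s30 s34.
have /andP[h3 _] := @phi_increment _ _ _ nd phiE _ _ (lexx 0) s30.
have h4 : phi (4 * s) <= L * phi (2 * s).
  by have := HL (2 * s) (ltW s20); rewrite mulrA (_ : 2 * 2 = 4 :> R)//; lra.
have h5 := HL s (ltW s0).
have [_ _ +] := @lderiv_bounds _ _ _ nd phiE s 0 s0 (zero_lt s0).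
rewrite phi0 subr0 ler_pdivrMr// => h6.
have lge0 := lderiv_ge0 s Phi.
rewrite phi0 subr0 p0 mulr0 in h3.
rewrite -(ler_pM2l s0); apply: (@le_trans _ _ (s * psi (3 * s))).
  by rewrite ler_pM2l.
apply: (@le_trans _ _ (phi (4 * s))); first by lra.
apply: (le_trans h4); apply: (@le_trans _ _ (L * (L * (lderiv phi s * s)))).
  by rewrite ler_pM2l// (le_trans h5)// ler_pM2l.
by have := mulr_ge0 lge0 (ltW s0); lra.
Qed.

End Phi_derivatives.

(** * Inequalities for polynomials in one variable *)

Section polynomial_on_unit_interval.
Context {R : realFieldType}.
Implicit Types (a : nat -> R) (M : R).

(* Passing from [p] to [p(s) - 2^m p(s/2)] removes the coefficient of degree
   [m] and does not decrease the modulus of the others. *)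
Lemma coef_bound m : exists2 C : R, 0 <= C & forall a M,
  (forall s, 0 <= s <= 1 -> `|\sum_(k < m.+1) a k * s ^+ k| <= M) ->
  forall k, (k <= m)%N -> `|a k| <= C * M.
Proof.
elim: m => [|m [C C0 HC]].
  exists 1 => // a M aM [|//] _; rewrite mul1r.
  have := aM 0; rewrite lexx ler01 big_ord_recl big_ord0 expr0 mulr1 addr0.
  exact.
pose D := C * (1 + 2 ^+ m.+1).
have D0 : 0 <= D by rewrite mulr_ge0// addr_ge0// exprn_ge0.
exists (1 + D *+ m.+1) => [|a M aM]; first by rewrite addr_ge0// mulrn_wge0.
have M0 : 0 <= M.
  by apply: le_trans (aM 0 _); rewrite ?normr_ge0// lexx ler01.
have aD k : (k <= m)%N -> `|a k| <= D * M.
  move=> km.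
  pose b j := a j * (1 - 2 ^+ (m.+1 - j)).
  have /HC/(_ k km) : forall s, 0 <= s <= 1 ->
      `|\sum_(j < m.+1) b j * s ^+ j| <= (1 + 2 ^+ m.+1) * M.
    move=> s s01.
    have -> : \sum_(j < m.+1) b j * s ^+ j =
        \sum_(j < m.+2) a j * s ^+ j
        - 2 ^+ m.+1 * \sum_(j < m.+2) a j * (s / 2) ^+ j.
      rewrite mulr_sumr -sumrB [RHS]big_ord_recr/=.
      rewrite expr_div_n [X in _ = _ + X](_ : _ = 0) ?addr0; last first.
        have pow0 : (2 : R) ^+ m.+1 != 0 by rewrite expf_neq0// pnatr_eq0.
        by rewrite mulrCA (mulrCA (2 ^+ _)) divff ?mulr1 ?subrr.
      apply: eq_bigr => j _; rewrite /b expr_div_n.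
      have jm : (j <= m.+1)%N by rewrite ltnW// ltn_ord.
      have -> : (2 : R) ^+ m.+1 = 2 ^+ (m.+1 - j) * 2 ^+ j.
        by rewrite -exprD subnK.
      have : (2 : R) ^+ j != 0 by rewrite expf_neq0// pnatr_eq0.
      by move=> ?; field.
    rewrite (le_trans (ler_normB _ _))// mulrDl mul1r lerD ?aM//.
    rewrite normrM ger0_norm ?exprn_ge0// ler_wpM2l ?exprn_ge0// aM//.
    by move: s01 => /andP[? ?]; apply/andP; split; lra.
  rewrite mulrA -/D; apply: le_trans.
  rewrite /b normrM ler_peMr// subSn// distrC ler_normr; apply/orP; left.
  have : 1 <= (2 : R) ^+ (m - k) by rewrite exprn_ege1// ler1n.
  by rewrite exprS; lra.
(* The top coefficient is the value at 1 minus the [m.+1] lower coefficients, each at most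
   [D * M]. *)
move=> k; rewrite leq_eqVlt => /predU1P[->|]; last first.
  rewrite ltnS => /aD /le_trans; apply.
  by rewrite ler_wpM2r// mulrS addrCA lerDl addr_ge0// mulrn_wge0.
have /(aM 1) : 0 <= (1 : R) <= 1 by rewrite ler01 lexx.
rewrite big_ord_recr/= expr1n mulr1 => aM1.
have : `|\sum_(j < m.+1) a j * 1 ^+ j| <= D *+ m.+1 * M.
  rewrite (le_trans (ler_norm_sum _ _ _))//.
  rewrite mulrnAl -[X in _ *+ X]card_ord -sumr_const ler_sum// => j _.
  by rewrite expr1n mulr1 aD// -ltnS.
move: aM1; rewrite mulrDl mul1r.
set S := \sum_(_ < _) _ => h1 h2.
have -> : a m.+1 = S + a m.+1 - S by rewrite addrAC subrr add0r.
by apply: le_trans (ler_normB _ _) _; exact: lerD.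
Qed.

(** Rescaling to the unit interval gives the coefficients [a k * r ^+ k], controlled by
    [coef_bound]; since [r <= 1], the worst division is by [r ^+ m]. *)
Lemma growth_bound m : exists2 C : R, 0 <= C & forall a M (r : R), 0 < r <= 1 ->
  (forall s, 0 <= s <= r -> `|\sum_(k < m.+1) a k * s ^+ k| <= M) ->
  `|\sum_(k < m.+1) a k| <= C * M / r ^+ m.
Proof.
have [C C0 HC] := coef_bound m.
exists (C *+ m.+1) => [|a M r /andP[r0 r1] aM]; first exact: mulrn_wge0.
have M0 : 0 <= M by apply: le_trans (aM 0 _); rewrite ?normr_ge0// lexx ltW.
pose b k := a k * r ^+ k.
have bM k : (k <= m)%N -> `|b k| <= C * M.
  apply: HC => s /andP[s0 s1].
  rewrite (eq_bigr (fun k : 'I__ => a k * (r * s) ^+ k)).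
    by apply: aM; rewrite mulr_ge0 ?(ltW r0)//= ler_piMr// ltW.
  by move=> j _; rewrite exprMn mulrA.
have -> : C *+ m.+1 * M / r ^+ m = \sum_(k < m.+1) C * M / r ^+ m.
  by rewrite sumr_const card_ord -!mulrnAl.
rewrite (le_trans (ler_norm_sum _ _ _))// ler_sum// => k _.
rewrite ler_pdivlMr ?exprn_gt0//.
have km : (k <= m)%N by rewrite -ltnS.
apply: le_trans (bM k km).
rewrite /b normrM ler_wpM2l// ger0_norm ?exprn_ge0 ?(ltW r0)//.
by rewrite ler_wiXn2l// ltW.
Qed.

(** The same rescaling with [1 <= r]: the constant term cancels, and every remaining coefficient
    gains at least one factor [r^-1]. *)
Lemma lipschitz_bound m : exists2 C : R, 0 <= C & forall a M (r : R), 1 <= r ->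
  (forall s, 0 <= s <= r -> `|\sum_(k < m.+1) a k * s ^+ k| <= M) ->
  `|\sum_(k < m.+1) a k - a 0%N| <= C * M / r.
Proof.
have [C C0 HC] := coef_bound m.
exists (C *+ m) => [|a M r r1 aM]; first exact: mulrn_wge0.
have r0 : 0 < r by apply: lt_le_trans r1.
have M0 : 0 <= M by apply: le_trans (aM 0 _); rewrite ?normr_ge0// lexx ltW.
pose b k := a k * r ^+ k.
have bM k : (k <= m)%N -> `|b k| <= C * M.
  apply: HC => s /andP[s0 s1].
  rewrite (eq_bigr (fun k : 'I__ => a k * (r * s) ^+ k)).
    by apply: aM; rewrite mulr_ge0 ?(ltW r0)//= ler_piMr// ltW.
  by move=> j _; rewrite exprMn mulrA.
rewrite big_ord_recl/= addrAC subrr add0r (le_trans (ler_norm_sum _ _ _))//.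
have -> : C *+ m * M / r = \sum_(k < m) C * M / r.
  by rewrite sumr_const card_ord -!mulrnAl.
rewrite ler_sum// => k _; rewrite ler_pdivlMr//.
apply: le_trans (bM (lift ord0 k) _); last by rewrite /= /bump/= add1n.
rewrite /b normrM ler_wpM2l// ger0_norm ?exprn_ge0 ?(ltW r0)//.
by rewrite /= /bump/= add1n exprS ler_peMr ?(ltW r0)// exprn_ege1.
Qed.

End polynomial_on_unit_interval.

(** * Restriction of multivariate polynomials to lines *)

Section multivariate.
Context {R : realFieldType} {n : nat}.
Implicit Types (P : mpoly.mpoly n R) (u v : 'I_n -> R).

Lemma meval_line P m u v : (mpoly.mmeasure mpoly.mdeg P <= m.+1)%N ->
  exists a : nat -> R, forall s,
    mpoly.meval (fun i => u i + s * v i) P = \sum_(k < m.+1) a k * s ^+ k.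
Proof.
move=> Pm.
pose q (w : mpoly.multinom n) : {poly R} :=
  mpoly.mcoeff w P *:
    \prod_i ((u i)%:P + v i *: 'X) ^+ (mpoly.fun_of_multinom w i).
pose p := \sum_(w <- mpoly.msupp P) q w.
have sp : (size p <= m.+1)%N.
  rewrite (leq_trans (size_sum _ _ _))//; apply/bigmax_leqP_seq => w wP _.
  rewrite (leq_trans (size_scale_leq _ _))//.
  apply: leq_trans (leq_trans (mpoly.msize_mdeg_lt wP) Pm).
  rewrite (leq_trans (size_prod_leq _ _))// mpoly.mdegE.
  (* [size] is one more than the degree: [n] factors of sizes at most [w i + 1] have a product of
     size at most one plus the sum of the [w i]. *)
  rewrite cardT size_enum_ord leq_subLR addnS ltnS addnC.
  rewrite (@leq_trans (\sum_(i < n) (mpoly.fun_of_multinom w i).+1))//; last first.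
    rewrite (eq_bigr (fun i => mpoly.fun_of_multinom w i + 1)%N) => [|i _].
      by rewrite big_split/= sum1_card card_ord.
    by rewrite addn1.
  rewrite leq_sum// => i _.
  rewrite (leq_trans (size_poly_exp_leq _ _))// ltnS.
  rewrite -[leqRHS]mul1n leq_mul2r; apply/orP; right.
  rewrite -ltnS; have : (size ((u i)%:P + v i *: 'X)%R <= 2)%N.
    rewrite (leq_trans (size_polyD _ _))// geq_max.
    rewrite (leq_trans (size_polyC_leq1 _))//=.
    by rewrite (leq_trans (size_scale_leq _ _))// size_polyX.
  by case: size => // -[].
exists (fun k => p`_k) => s.
rewrite -horner_coef_wide// mpoly.mevalE horner_sum; apply: eq_bigr => w _.
rewrite hornerZ horner_prod; congr (_ * _); apply: eq_bigr => i _.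
by rewrite horner_exp !hornerE [v i * s]mulrC.
Qed.

Lemma meval_bounded P (r : R) : 0 <= r ->
  exists M : R, forall u, (forall i, `|u i| <= r) -> `|mpoly.meval u P| <= M.
Proof.
move=> r0; exists (\sum_(w <- mpoly.msupp P)
  `|mpoly.mcoeff w P| * \prod_(i < n) r ^+ (mpoly.fun_of_multinom w i)).
move=> u ur; rewrite mpoly.mevalE (le_trans (ler_norm_sum _ _ _))// ler_sum//.
move=> w _; rewrite normrM ler_wpM2l// normr_prod ler_prod// => i _.
by rewrite normr_ge0 normrX lerXn2r// nnegrE.
Qed.

End multivariate.

(** * Polynomial bounds on cubes *)

Section polynomials_on_cubes.
Context {R : realType} {n : nat}.
Implicit Types (Q : mpoly.mpoly n R) (c y : 'I_n -> R).

Definition cube c (rho : R) : set ('I_n -> R) :=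
  [set y | forall i, `|y i - c i| <= rho].

(** On the line through [c] and [y], parametrized with [c] at 0 and [y] at 1, parameters in [[0, r]]
    stay in the cube, so [growth_bound] applies. *)
Lemma meval_growth m : exists2 C : R, 0 <= C & forall Q c (rho M r : R) y,
  poly_space m Q -> (forall z, cube c rho z -> `|mpoly.meval z Q| <= M) ->
  0 < r <= 1 -> (forall i, r * `|y i - c i| <= rho) ->
  `|mpoly.meval y Q| <= C * M / r ^+ m.
Proof.
have [C C0 HC] := @growth_bound R m.
exists C => // Q c rho M r y Qm QM r01 yr.
have [a aE] := meval_line c (fun i => y i - c i) Qm.
have -> : mpoly.meval y Q = \sum_(k < m.+1) a k.
  have -> : y = fun i => c i + 1 * (y i - c i).
    by apply/funext => i; rewrite mul1r addrCA subrr addr0.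
  by rewrite aE; apply: eq_bigr => k _; rewrite expr1n mulr1.
apply: HC => // s /andP[s0 sr]; rewrite -aE; apply: QM => i.
by rewrite addrAC subrr add0r normrM ger0_norm// (le_trans _ (yr i))// ler_wpM2r.
Qed.

(* At a point where [|Q|] is at least half of its supremum, a small cube
   directed towards the center stays inside, and along the segments from that
   point [Q] is a polynomial of one variable, hence varies slowly. *)
Lemma meval_large_on_subcube m : exists2 d : R, 0 < d <= 1 &
  forall Q c (rho : R), poly_space m Q -> 0 < rho ->
  exists M, [/\ 0 <= M, forall y, cube c rho y -> `|mpoly.meval y Q| <= M &
    exists lo : 'I_n -> R, forall y, (forall i, lo i <= y i <= lo i + d * rho) ->
      cube c rho y /\ M / 4 <= `|mpoly.meval y Q|].
Proof.
have [C C0 HC] := @lipschitz_bound R m.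
have C40 : 0 < 1 + 4 * C by lra.
(* This makes the variation [C * M * d] at most [M / 4], so a value of at least [M / 2] at one point
   leaves [M / 4] on the subcube. *)
exists (1 + 4 * C)^-1 => [|Q c rho Qm rho0].
  by rewrite invr_gt0 C40 invf_le1//; lra.
set d := _^-1; have d0 : 0 < d by rewrite invr_gt0.
have d1 : d <= 1 by rewrite invf_le1//; lra.
pose S := [set `|mpoly.meval y Q| | y in cube c rho].
have Kc : cube c rho c by move=> i; rewrite subrr normr0 ltW.
have supS : has_sup S.
  split; first by exists `|mpoly.meval c Q|, c.
  have rc0 : 0 <= rho + \sum_i `|c i|.
    by apply: addr_ge0; [exact: ltW|exact: sumr_ge0].
  have [M HM] := meval_bounded Q rc0.
  exists M => _ [y Ky <-]; apply: HM => i.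
  rewrite -[y i](subrK (c i)) (le_trans (ler_normD _ _))// lerD ?Ky//.
  by rewrite (bigD1 i)//= lerDl sumr_ge0.
have QM y : cube c rho y -> `|mpoly.meval y Q| <= sup S.
  by move=> Ky; apply: ub_le_sup; [exact: supS.2|exists y].
have M0 : 0 <= sup S by apply: le_trans (QM c Kc).
exists (sup S); split => //.
have [z Kz zM] : exists2 z, cube c rho z & sup S / 2 <= `|mpoly.meval z Q|.
  have [->|Mneq0] := eqVneq (sup S) 0; first by exists c; rewrite ?mul0r.
  have M2 : 0 < sup S / 2 by rewrite divr_gt0// lt_neqAle eq_sym Mneq0.
  have [_ [z Kz <-] zM] := sup_adherent M2 supS.
  by exists z => //; lra.
exists (fun i => if z i <= c i then z i else z i - d * rho) => y yz.
(* A displacement inside the subcube, stretched by [d^-1], has length at most [rho] in each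
   coordinate and points in the direction of [c i], so it stays in the cube. *)
have yzc i s : 0 <= s -> s <= d^-1 -> `|z i + s * (y i - z i) - c i| <= rho.
  move=> s0 sd; move: (yz i) (Kz i); rewrite !ler_norml.
  have sdrho : s * (d * rho) <= rho.
    by rewrite mulrA ler_piMl ?(ltW rho0)// -ler_pdivlMr// div1r.
  case: ifPn => [zc /andP[y1 y2] /andP[z1 z2]|]; last first.
    rewrite -ltNge => cz /andP[y1 y2] /andP[z1 z2].
    have : s * (z i - y i) <= s * (d * rho) by rewrite ler_wpM2l//; lra.
    have : 0 <= s * (z i - y i) by rewrite mulr_ge0//; lra.
    by move=> ? ?; apply/andP; split; lra.
  have : s * (y i - z i) <= s * (d * rho) by rewrite ler_wpM2l//; lra.
  have : 0 <= s * (y i - z i) by rewrite mulr_ge0//; lra.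
  by move=> ? ?; apply/andP; split; lra.
have d1V : 1 <= d^-1 by rewrite invf_ge1.
split=> [i|].
  by have := yzc i 1 ler01 d1V; rewrite mul1r addrCA subrr addr0.
have [a aE] := meval_line z (fun i => y i - z i) Qm.
have aM s : 0 <= s <= d^-1 -> `|\sum_(k < m.+1) a k * s ^+ k| <= sup S.
  by move=> /andP[s0 sd]; rewrite -aE; apply: QM => i; exact: yzc.
have := HC a (sup S) d^-1 d1V aM.
have -> : \sum_(k < m.+1) a k = mpoly.meval y Q.
  have -> : y = fun i => z i + 1 * (y i - z i).
    by apply/funext => i; rewrite mul1r addrCA subrr addr0.
  by rewrite aE; apply: eq_bigr => k _; rewrite expr1n mulr1.
have -> : a 0%N = mpoly.meval z Q.
  have -> : z = fun i => z i + 0 * (y i - z i).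
    by apply/funext => i; rewrite mul0r addr0.
  rewrite aE big_ord_recl expr0 mulr1 big1 ?addr0// => k _.
  by rewrite expr0n mulr0.
rewrite invrK => yzM.
have CMd : C * sup S * d <= sup S / 4.
  have dE : d * (1 + 4 * C) = 1 by rewrite mulVf// gt_eqF.
  by rewrite -mulrA mulrCA ler_wpM2l//; lra.
have := ler_normB (mpoly.meval y Q) (mpoly.meval y Q - mpoly.meval z Q).
by rewrite opprB addrCA subrr addr0; lra.
Qed.

End polynomials_on_cubes.

(** * Lebesgue measure of boxes and balls *)

Section lebesgue_boxes.
Context {R : realType} {n : nat}.
Local Notation mu := (@lebesgue_Rn R n).
Implicit Types (t x : Rn R n) (P : mpoly.mpoly n R).

Lemma measurable_coord (i : 'I_n) :
  measurable_fun [set: Rn R n] (fun t => coord t i).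
Proof.
move=> _ Y mY; rewrite setTI.
have := @measurable_tnth _ (measurableTypeR R) n i measurableT Y mY.
by rewrite setTI => /lebesgue_Rn_borel[].
Qed.

Lemma measurable_peval P : measurable_fun [set: Rn R n] (peval P).
Proof.
have -> : peval P = (fun t => \sum_(w <- mpoly.msupp P)
    mpoly.mcoeff w P * \prod_(i < n) coord t i ^+ mpoly.fun_of_multinom w i).
  by apply/funext => t; rewrite /peval mpoly.mevalE.
apply: measurable_sum => w; apply: measurable_funM; first exact: measurable_cst.
by apply: measurable_prod => i _; apply: measurable_funX; exact: measurable_coord.
Qed.

Lemma measurable_eball x e : measurable (eball x e).
Proof.
rewrite -[eball x e]setTI.
have mS : measurable_fun [set: Rn R n]
    (fun t => Num.sqrt (\sum_(i < n) (coord t i - coord x i) ^+ 2)).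
  apply: (@measurableT_comp _ _ _ _ _ _ (@Num.sqrt R)).
    exact: continuous_measurable_fun (@sqrt_continuous R).
  apply: measurable_sum => i; apply: measurable_funX.
  by apply: measurable_funB; [exact: measurable_coord|exact: measurable_cst].
have := mS measurableT `]-oo, e[%classic (measurable_itv _).
congr measurable; apply/seteqP; split => t; rewrite /= in_itv/=; tauto.
Qed.

Definition box (lo : 'I_n -> R) (w : R) : set (Rn R n) :=
  [set t | forall i, lo i <= coord t i <= lo i + w].

Lemma measurable_box_measure lo w : 0 <= w ->
  measurable (box lo w) /\ mu (box lo w) = (w ^+ n)%:E.
Proof.
move=> w0.
pose A (i : 'I_n) : set (measurableTypeR R) := `[lo i, lo i + w]%classic.
have mA i : measurable (A i) by exact: measurable_itv.
have -> : box lo w = [set t | forall i, A i (tnth t i)].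
  by apply/seteqP; split => t H i; have := H i; rewrite /A/= in_itv.
have mB : measurable
    [set t : n.-tuple (measurableTypeR R) | forall i, A i (tnth t i)].
  have -> : [set t : n.-tuple (measurableTypeR R) | forall i, A i (tnth t i)] =
      \bigcap_(i in [set: 'I_n]) ((@tnth n _ ^~ i) @^-1` A i).
    by apply/seteqP; split => t H i; [move=> _|]; exact: H.
  apply: fin_bigcap_measurable => [|i _]; first exact: finite_finset.
  by rewrite -[X in measurable X]setTI; exact: measurable_tnth.
have [mB' ->] := lebesgue_Rn_borel mB; split => //.
rewrite product_lebesgue_box// (eq_bigr (fun=> w%:E)) => [|i _]; last first.
  rewrite lebesgue_measure_itv/= lte_fin; case: ifPn => [_|].
    by rewrite -EFinD addrAC subrr add0r.
  by rewrite ltrDl -leNgt => w0'; congr EFin; apply/eqP; rewrite eq_le w0 w0'.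
by rewrite prodEFin prodr_const card_ord.
Qed.

(** The half side [e / n.+1%:R] works because [n < (n + 1) ^ 2]; this gives the strict inequality of
    the open ball and covers [n = 0]. *)
Lemma cube_sub_eball x (e : R) : 0 < e ->
  [set t | cube (coord x) (e / n.+1%:R) (coord t)] `<=` eball x e.
Proof.
move=> e0 t xt; rewrite /eball/= -[ltRHS]ger0_norm ?(ltW e0)// -sqrtr_sqr.
rewrite ltr_sqrt ?exprn_gt0//.
apply: (@le_lt_trans _ _ (\sum_(i < n) (e / n.+1%:R) ^+ 2)).
  apply: ler_sum => i _; rewrite -real_normK ?num_real// lerXn2r ?nnegrE//.
  by rewrite divr_ge0// ltW.
rewrite sumr_const card_ord expr_div_n -mulrnAr gtr_pMr ?exprn_gt0// -mulr_natl.
rewrite ltr_pdivrMr ?exprn_gt0// mul1r -natrX ltr_nat.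
by rewrite -mulnn mulSn; lia.
Qed.

Lemma eball_coord x e t i : eball x e t -> `|coord t i - coord x i| <= e.
Proof.
move=> xt; rewrite -sqrtr_sqr (le_trans _ (ltW xt))// ler_sqrt.
  by rewrite (bigD1 i)//= lerDl sumr_ge0// => j _; exact: sqr_ge0.
by rewrite sumr_ge0// => j _; exact: sqr_ge0.
Qed.

Lemma eball_sub_box x e : eball x e `<=` box (fun i => coord x i - e) (e *+ 2).
Proof.
move=> t /eball_coord xt i; have := xt i; rewrite ler_norml => /andP[? ?].
by apply/andP; split; rewrite /= ?mulr2n; lra.
Qed.

Lemma eball_measure_le x e : 0 <= e -> (mu (eball x e) <= ((e *+ 2) ^+ n)%:E)%E.
Proof.
move=> e0; have e20 : 0 <= e *+ 2 by rewrite mulrn_wge0.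
have [mb <-] := measurable_box_measure (fun i => coord x i - e) e20.
by apply: le_measure; rewrite ?inE//; [exact: measurable_eball|exact: eball_sub_box].
Qed.

Lemma eball_measure_gt0 x e : 0 < e -> (0 < mu (eball x e))%E.
Proof.
move=> e0; have rho0 : 0 < e / n.+1%:R by rewrite divr_gt0.
have [mb mbE] := measurable_box_measure (coord x) (ltW rho0).
apply: (@lt_le_trans _ _ (mu (box (coord x) (e / n.+1%:R)))).
  by rewrite mbE lte_fin exprn_gt0.
apply: le_measure; rewrite ?inE//; first exact: measurable_eball.
move=> t xt; apply: cube_sub_eball => // i.
by have /andP[? ?] := xt i; rewrite ger0_norm ?subr_ge0// lerBlDl.
Qed.

End lebesgue_boxes.

(** * Comparison of integrals of nonnegative functions *)

Section integral_comparison.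
Context d (T : measurableType d) (R : realType) (mu : {measure set T -> \bar R}).
Implicit Types (D S : set T) (f g h : T -> R).

Lemma measurable_lt_set f g : measurable_fun [set: T] f ->
  measurable_fun [set: T] g -> measurable [set t | f t < g t].
Proof.
move=> mf mg; rewrite -[X in measurable X]setTI.
exact: (measurable_fun_ltr mf mg measurableT (Y := [set true])).
Qed.

Lemma measurable_EFin_on D f : measurable_fun [set: T] f ->
  measurable_fun D (fun t => (f t)%:E).
Proof. by move=> mf; apply/measurable_EFinP; exact: measurable_funTS. Qed.

Lemma integral_setI_indicE D S f :
  (\int[mu]_(t in D `&` S) (f t)%:E = \int[mu]_(t in D) (f t * \1_S t)%:E)%E.
Proof.
rewrite integral_mkcondr; apply: eq_integral => t _.
by rewrite epatch_indic/= EFinM.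
Qed.

(** The integral of [h] is at most [C] times the [wl] integrals plus that of [g]; the assumed
    inequality replaces the [wl] integrals by the [wr] ones, again at most the integral of [g].
    Hence the factor [C *+ 2]. *)
Lemma ge0_le_integral_sum D S1 S2 O1 O2 (wl wr g h : T -> R) (C : R) : 0 <= C ->
  measurable D -> measurable S1 -> measurable S2 ->
  measurable O1 -> measurable O2 ->
  measurable_fun [set: T] wl -> measurable_fun [set: T] wr ->
  measurable_fun [set: T] g -> measurable_fun [set: T] h ->
  (forall t, 0 <= wl t) -> (forall t, 0 <= wr t) ->
  (forall t, 0 <= g t) -> (forall t, 0 <= h t) ->
  (forall t, h t <= C * (wl t * \1_S1 t + wl t * \1_S2 t + g t)) ->
  (forall t, wr t * \1_O1 t + wr t * \1_O2 t <= g t) ->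
  (\int[mu]_(t in D `&` S1) (wl t)%:E + \int[mu]_(t in D `&` S2) (wl t)%:E <=
   \int[mu]_(t in D `&` O1) (wr t)%:E + \int[mu]_(t in D `&` O2) (wr t)%:E ->
   \int[mu]_(t in D) (h t)%:E <= (C *+ 2)%:E * \int[mu]_(t in D) (g t)%:E)%E.
Proof.
move=> C0 mD mS1 mS2 mO1 mO2 mwl mwr mg mh wl0 wr0 g0 h0 hle gge.
have mfD (k : T -> R) : measurable_fun [set: T] k -> measurable_fun D (EFin \o k).
  by move=> mk; apply/measurable_EFinP; exact: measurable_funTS.
have mI (k : T -> R) S : measurable S -> measurable_fun [set: T] k ->
    measurable_fun [set: T] (fun t => k t * \1_S t).
  by move=> mS mk; apply: measurable_funM => //; exact: measurable_indic.
have I0 (k : T -> R) S t : (forall t, 0 <= k t) -> 0 <= k t * \1_S t.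
  by move=> k0; rewrite mulr_ge0.
rewrite !integral_setI_indicE => lr.
have splitD (f1 f2 : T -> R) :
    measurable_fun [set: T] f1 -> measurable_fun [set: T] f2 ->
    (forall t, 0 <= f1 t) -> (forall t, 0 <= f2 t) ->
    (\int[mu]_(t in D) (f1 t + f2 t)%:E =
     \int[mu]_(t in D) (f1 t)%:E + \int[mu]_(t in D) (f2 t)%:E)%E.
  move=> mf1 mf2 f10 f20; under eq_integral do rewrite EFinD.
  by rewrite ge0_integralD//; [move=> t _; rewrite lee_fin|exact: mfD|
    move=> t _; rewrite lee_fin|exact: mfD].
have mS1S2 := measurable_funD (mI wl S1 mS1 mwl) (mI wl S2 mS2 mwl).
have mO1O2 := measurable_funD (mI wr O1 mO1 mwr) (mI wr O2 mO2 mwr).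
have S0 t : 0 <= wl t * \1_S1 t + wl t * \1_S2 t by rewrite addr_ge0 ?I0.
rewrite -!splitD in lr; [|by auto..].
have gO : (\int[mu]_(t in D) (wr t * \1_O1 t + wr t * \1_O2 t)%:E <=
    \int[mu]_(t in D) (g t)%:E)%E.
  apply: ge0_le_integral => //.
  - by move=> t _; rewrite lee_fin addr_ge0 ?I0.
  - exact: mfD.
  - exact: mfD.
  - by move=> t _; rewrite lee_fin.
apply: (@le_trans _ _ (\int[mu]_(t in D)
    (C%:E * (wl t * \1_S1 t + wl t * \1_S2 t + g t)%:E)))%E.
  apply: ge0_le_integral => //.
  - by move=> t _; rewrite lee_fin.
  - exact: mfD.
  - apply: measurable_funeM; apply: mfD; exact: measurable_funD.
  - by move=> t _; rewrite -EFinM lee_fin.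
rewrite ge0_integralZl//=; last 2 first.
  - by apply: mfD; exact: measurable_funD.
  - by move=> t _; rewrite lee_fin addr_ge0.
rewrite splitD// mulr2n EFinD ge0_muleDl ?lee_fin// ge0_muleDr ?integral_ge0//;
  [|by move=> t _; rewrite lee_fin..].
rewrite leeD2r// lee_wpmul2l ?lee_fin//.
exact: le_trans gO.
Qed.

Lemma ge0_integral_ge_cst D S (h : T -> R) (c v : R) : 0 <= c ->
  measurable D -> measurable S -> S `<=` D -> mu S = v%:E ->
  measurable_fun [set: T] h -> (forall t, 0 <= h t) ->
  (forall t, S t -> c <= h t) ->
  ((c * v)%:E <= \int[mu]_(t in D) (h t)%:E)%E.
Proof.
move=> c0 mD mS SD muS mh h0 ch; rewrite EFinM -muS -integral_cst//.
apply: (@le_trans _ _ (\int[mu]_(t in S) (h t)%:E)%E).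
  by apply: ge0_le_integral => //; exact: measurable_EFin_on.
apply: ge0_subset_integral => //; first exact: measurable_EFin_on.
by move=> t _; rewrite lee_fin.
Qed.

Lemma ge0_integralM_le D (g k : T -> R) (M : R) : 0 <= M ->
  measurable D -> measurable_fun [set: T] g -> measurable_fun [set: T] k ->
  (forall t, 0 <= g t) -> (forall t, 0 <= k t) ->
  (forall t, D t -> k t <= M) ->
  (\int[mu]_(t in D) (g t * k t)%:E <= M%:E * \int[mu]_(t in D) (g t)%:E)%E.
Proof.
move=> M0 mD mg mk g0 k0 kM; rewrite -ge0_integralZl//=; last 2 first.
- exact: measurable_EFin_on.
- by move=> t _; rewrite lee_fin.
apply: ge0_le_integral => //.
- by move=> t _; rewrite lee_fin mulr_ge0.
- by apply: measurable_EFin_on; exact: measurable_funM.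
- by apply: measurable_funeM; exact: measurable_EFin_on.
- by move=> t Dt; rewrite -EFinM lee_fin mulrC ler_wpM2r// kM.
Qed.

End integral_comparison.

(** * Testing the best approximation inequality *)

Section best_approximation.
Context {R : realType} {n : nat}.
Local Notation mu := (@lebesgue_Rn R n).
Implicit Types (phi : R -> R) (f : Rn R n -> R) (x t : Rn R n)
  (p q : mpoly.mpoly n R).

(** [|a - b|] is at most twice the larger of [|a|] and [|b|]; doubling applies there, and the larger
    of two nonnegative values is at most their sum. *)
Lemma rderiv_triangle phi C (a b : R) : class_Phi phi ->
  (forall s, 0 <= s -> rderiv phi (2 * s) <= C * lderiv phi s) -> 0 <= C ->
  rderiv phi `|a - b| <= C * (lderiv phi `|a| + lderiv phi `|b|).
Proof.
move=> Phi HC C0; set s := Num.max `|a| `|b|.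
have s0 : 0 <= s by rewrite le_max normr_ge0.
apply: (@le_trans _ _ (C * lderiv phi s)).
  apply: le_trans (HC s s0); apply: rderiv_homo => //.
  rewrite (le_trans (ler_normB _ _))// mulr_natl mulr2n lerD//.
    by rewrite le_max lexx.
  by rewrite le_max lexx orbT.
rewrite ler_wpM2l// /s; have l0 r := lderiv_ge0 r Phi.
by case: (leP `|a| `|b|) => _; rewrite ?lerDl ?lerDr.
Qed.

Lemma ler_dist_between (a b c : R) : a <= b -> b <= c ->
  `|b - a| <= `|c - a| /\ `|c - b| <= `|c - a|.
Proof. by move=> ab bc; rewrite !ger0_norm; lra. Qed.

Lemma measurable_rderiv_norm phi f : class_Phi phi ->
  measurable_fun [set: Rn R n] f ->
  measurable_fun [set: Rn R n] (fun t => rderiv phi `|f t|).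
Proof.
move=> Phi mf; apply: (@measurableT_comp _ _ _ _ _ _ (rderiv phi)).
  by apply: nondecreasing_measurable => //; exact: rderiv_homo.
exact: measurableT_comp.
Qed.

Lemma measurable_lderiv_norm phi f : class_Phi phi ->
  measurable_fun [set: Rn R n] f ->
  measurable_fun [set: Rn R n] (fun t => lderiv phi `|f t|).
Proof.
move=> Phi mf; apply: (@measurableT_comp _ _ _ _ _ _ (lderiv phi)).
  by apply: nondecreasing_measurable => //; exact: lderiv_homo.
exact: measurableT_comp.
Qed.

Lemma poly_spaceB m p q : poly_space m p -> poly_space m q -> poly_space m (q - p).
Proof.
rewrite /poly_space/= => pm qm; apply: leq_trans (mpoly.msizeD_le _ _) _.
by rewrite geq_max qm mpoly.msizeN.
Qed.

Lemma pevalB p q t : peval (q - p) t = peval q t - peval p t.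
Proof. exact: mpoly.mevalB. Qed.

(** [p] is bounded on the ball, so [rderiv_triangle] dominates the integrand by a multiple of
    [rderiv phi] of [|f|] plus a constant. This makes the real-valued mean a genuine integral. *)
Lemma integrable_rderiv_sub phi f x e p : class_Phi phi ->
  L_loc (rderiv phi) f -> 0 <= e ->
  mu.-integrable (eball x e) (fun t => (rderiv phi `|f t - peval p t|)%:E).
Proof.
move=> Phi [mf fint] e0.
have [C C1 HC] := rderiv_doubling Phi.
have C0 : 0 <= C by apply: le_trans C1.
have mB := measurable_eball x e.
have mfp := measurable_funB mf (measurable_peval p).
have r0 : 0 <= e + \sum_i `|coord x i|.
  by apply: addr_ge0 => //; exact: sumr_ge0.
have [N HN] := meval_bounded p r0.
have Bfin : (mu (eball x e) < +oo)%E.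
  by apply: le_lt_trans (eball_measure_le x e0) _; rewrite ltry.
have cint : mu.-integrable (eball x e) (EFin \o (fun=> C * rderiv phi `|N|)).
  apply: measurable_bounded_integrable => //.
  exists (`|C * rderiv phi `|N| |); split; first exact: num_real.
  by move=> M cM r _ /=; exact/ltW.
have fint' : mu.-integrable (eball x e)
    (fun t => C%:E * (rderiv phi `|f t|)%:E + (C * rderiv phi `|N|)%:E)%E.
  apply: integrableD => //; apply: integrableZl => //.
  by apply: fint => //; exists x, e.
refine (@le_integrable _ _ _ mu _ mB _ _ _ _ fint').
  exact: measurable_EFin_on (measurable_rderiv_norm Phi mfp).
move=> t Bt; rewrite -EFinM -EFinD !abse_EFin lee_fin.
have rge0 := fun s => rderiv_ge0 s Phi.
rewrite (ger0_norm (rge0 _)) [leRHS]ger0_norm ?addr_ge0 ?mulr_ge0// -mulrDr.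
apply: le_trans (rderiv_triangle _ _ Phi HC C0) _.
rewrite ler_wpM2l// lerD ?lderiv_le_rderiv//.
apply: le_trans (lderiv_le_rderiv _ Phi) _; apply: rderiv_homo => //.
apply: le_trans (ler_norm N); apply: HN => i.
have xti := eball_coord i Bt.
rewrite -[coord t i](subrK (coord x i)) (le_trans (ler_normD _ _))// lerD//.
by rewrite (bigD1 i)//= lerDl sumr_ge0.
Qed.

(* Where [f - p] and [q - p] have opposite signs, [q] is at least as far from
   [f] as from [p]; elsewhere the doubling condition bounds [psi^+(|q - p|)] by
   [psi^-(|f - p|)] and [psi^+(|f - q|)]. *)
Lemma best_approx_integral_le phi C m f x e p q : class_Phi phi -> 1 <= C ->
  (forall s, 0 <= s -> rderiv phi (2 * s) <= C * lderiv phi s) ->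
  measurable_fun [set: Rn R n] f ->
  ext_best_approx phi m f x e p -> poly_space m q ->
  (\int[mu]_(t in eball x e)
     (rderiv phi `|peval (q - p) t| * `|peval (q - p) t|)%:E
   <= (C *+ 2)%:E * \int[mu]_(t in eball x e)
        (rderiv phi `|f t - peval q t| * `|peval (q - p) t|)%:E)%E.
Proof.
move=> Phi C1 HC mf [pm pbest] qm.
have C0 : 0 <= C by apply: le_trans C1.
have /= := pbest (q - p) (poly_spaceB pm qm); rewrite -!setIA.
have mp := measurable_peval p; have mq := measurable_peval q.
have mQ := measurable_peval (q - p).
have m0 : measurable_fun [set: Rn R n] (fun=> 0 : R) by [].
have [m1 m2] := (measurable_lt_set mp mf, measurable_lt_set mf mp).
have [m3 m4] := (measurable_lt_set m0 mQ, measurable_lt_set mQ m0).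
have mfp := measurable_funB mf mp; have mfq := measurable_funB mf mq.
have mN : measurable_fun [set: Rn R n] (fun t => `|peval (q - p) t|).
  exact: measurableT_comp.
have lge0 := fun s => lderiv_ge0 s Phi; have rge0 := fun s => rderiv_ge0 s Phi.
have indI (b1 b2 : Rn R n -> bool) t :
    \1_([set t | b1 t] `&` [set t | b2 t]) t = (b1 t && b2 t)%:R :> R.
  rewrite indicE; congr (nat_of_bool _)%:R.
  by apply/idP/idP => [|/andP H]; rewrite inE => //= -[-> ->].
have mB := measurable_eball x e.
have mwl := measurable_funM (measurable_lderiv_norm Phi mfp) mN.
have mwr := measurable_funM (measurable_rderiv_norm Phi mfp) mN.
have mg := measurable_funM (measurable_rderiv_norm Phi mfq) mN.
have mh := measurable_funM (measurable_rderiv_norm Phi mQ) mN.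
have l0 k t : 0 <= lderiv phi (k t) * `|peval (q - p) t| by rewrite mulr_ge0.
have r0 k t : 0 <= rderiv phi (k t) * `|peval (q - p) t| by rewrite mulr_ge0.
(* The first two sets are where [f - p] and [q - p] have the same strict sign, the last two where
   their signs are strictly opposite. *)
apply: (ge0_le_integral_sum C0 mB
  (measurableI _ _ m1 m3) (measurableI _ _ m2 m4)
  (measurableI _ _ m2 m3) (measurableI _ _ m1 m4) mwl mwr mg mh
  (l0 _) (r0 _) (r0 _) (r0 _)).
- move=> t; rewrite !indI /= pevalB subr_gt0 subr_lt0.
  have tri := rderiv_triangle (f t - peval p t) (f t - peval q t) Phi HC C0.
  rewrite opprB addrC addrA subrK in tri.
  set Q := `|peval q t - peval p t| in tri *.
  have Q0 : 0 <= Q by exact: normr_ge0.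
  have triQ := ler_wpM2r Q0 tri.
  have far : Q <= `|f t - peval q t| -> rderiv phi Q * Q <=
      C * (rderiv phi `|f t - peval q t| * Q).
    move=> /(rderiv_homo Phi)/(ler_wpM2r Q0)/le_trans; apply.
    by rewrite ler_peMl// mulr_ge0.
  have wl0 : 0 <= C * (lderiv phi `|f t - peval p t| * Q).
    by rewrite !mulr_ge0.
  have triQ' : rderiv phi Q * Q <= C * (lderiv phi `|f t - peval p t| * Q
      + rderiv phi `|f t - peval q t| * Q).
    apply: (le_trans triQ); rewrite -mulrA ler_wpM2l// mulrDl lerD2l.
    by rewrite ler_wpM2r// lderiv_le_rderiv.
  case: (ltgtP (peval p t) (f t)) => pf;
    case: (ltgtP (peval p t) (peval q t)) => pq;
    rewrite /= ?mulr0 ?mulr1 ?add0r ?addr0//;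
    apply: far; rewrite /Q ?pq ?pf ?subrr ?normr0//.
  + by rewrite distrC; exact: (ler_dist_between (ltW pq) (ltW pf)).1.
  + by rewrite [leRHS]distrC; exact: (ler_dist_between (ltW pf) (ltW pq)).2.
  + by rewrite distrC.
  + by rewrite distrC.
(* On the sets of opposite sign [p] lies between [f] and [q], hence is no farther from [f] than [q]
   is. *)
- move=> t; rewrite !indI /= pevalB subr_gt0 subr_lt0.
  set Q := `|peval q t - peval p t|.
  have Q0 : 0 <= Q by exact: normr_ge0.
  have near_le : `|f t - peval p t| <= `|f t - peval q t| ->
      rderiv phi `|f t - peval p t| * Q <= rderiv phi `|f t - peval q t| * Q.
    by move=> /(rderiv_homo Phi)/(ler_wpM2r Q0).
  have g0 : 0 <= rderiv phi `|f t - peval q t| * Q by rewrite mulr_ge0.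
  case: (ltgtP (peval p t) (f t)) => pf;
    case: (ltgtP (peval p t) (peval q t)) => pq;
    rewrite /= ?mulr0 ?mulr1 ?add0r ?addr0//; apply: near_le.
  + exact: (ler_dist_between (ltW pq) (ltW pf)).2.
  + rewrite distrC [leRHS]distrC.
    exact: (ler_dist_between (ltW pf) (ltW pq)).1.
Qed.

End best_approximation.

(** * From the integral estimate to a supremum bound *)

Section sup_estimate.
Context {R : realType} {n : nat}.
Local Notation mu := (@lebesgue_Rn R n).
Implicit Types (phi : R -> R) (f : Rn R n -> R) (x t : Rn R n)
  (p q : mpoly.mpoly n R).

(** [K] is chosen before [f], [x] and [e]: this uniformity is what allows the radius to tend to
    0. *)
Lemma best_approx_sup_le phi m : class_Phi phi -> exists2 K : R, 0 < K &
  forall f x (e : R) p q, L_loc (rderiv phi) f -> 0 < e ->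
  ext_best_approx phi m f x e p -> poly_space m q ->
  exists M, [/\ 0 <= M,
    forall y, cube (coord x) (e / n.+1%:R) y -> `|mpoly.meval y (q - p)| <= M &
    rderiv phi (M / 4) <= K * ((fine (mu (eball x e)))^-1 *
      \int[mu]_(t in eball x e) rderiv phi `|f t - peval q t|)].
Proof.
move=> Phi; have [C C1 HC] := rderiv_doubling Phi.
have [G G0 HG] := @meval_growth R n m.
have [d /andP[d0 d1] Hd] := @meval_large_on_subcube R n m.
have C0 : 0 <= C by apply: le_trans C1.
have rge0 s : 0 <= rderiv phi s := rderiv_ge0 s Phi.
pose N : R := n.+1%:R; have N0 : 0 < N by rewrite ltr0n.
have N1 : 1 <= N by rewrite ler1n.
(* A factor [2 * C] comes from testing, 4 from [M / 4], [G * N ^+ m] from growth between inscribed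
   cube and ball, and the last power bounds the ratio of the volumes of ball and subcube. *)
pose K0 := C *+ 8 * G * N ^+ m * (2 * N / d) ^+ n.
have K00 : 0 <= K0.
  have N0' := ltW N0; have d0' := ltW d0.
  by rewrite !mulr_ge0 ?mulrn_wge0 ?exprn_ge0 ?divr_ge0 ?mulr_ge0.
(* [G] is only known to be nonnegative; adding 1 makes the constant positive. *)
exists (1 + K0) => [|f x e p q fL e0 pbest qm]; first by rewrite ltr_pwDl.
have rho0 : 0 < e / N by rewrite divr_gt0.
have pm : poly_space m p by case: pbest.
have Qm := poly_spaceB pm qm.
have [M [M0 QM [lo boxQ]]] := Hd (q - p) (coord x) (e / N) Qm rho0.
exists M; split=> //.
set B := eball x e; set b := fine (mu B); set j := Rintegral _ _ _.
have mB : measurable B := measurable_eball x e.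
have jE : (\int[mu]_(t in B) (rderiv phi `|f t - peval q t|)%:E = j%:E)%E.
  have fint := integrable_rderiv_sub x q Phi fL (ltW e0).
  by rewrite /j /Rintegral fineK//; exact: integrable_fin_num fint.
have j0 : 0 <= j by apply: Rintegral_ge0 => t _; exact: rge0.
have muBfin : mu B \is a fin_num.
  rewrite ge0_fin_numE//; apply: le_lt_trans (eball_measure_le x (ltW e0)) _.
  exact: ltry.
have b0 : 0 < b by rewrite fine_gt0// eball_measure_gt0// -ge0_fin_numE.
have be : b <= (e *+ 2) ^+ n.
  by rewrite -lee_fin fineK// eball_measure_le// ltW.
have mean0 : 0 <= b^-1 * j by rewrite mulr_ge0// invr_ge0 ltW.
(* A factor [M] is cancelled below; for [M = 0] the left side is the default value
   [rderiv phi 0 = 0]. *)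
have [Meq0|Mneq0] := eqVneq M 0.
  rewrite Meq0 mul0r {1}/rderiv ltxx mulr_ge0// addr_ge0//.
have Mgt0 : 0 < M by rewrite lt_neqAle eq_sym Mneq0.
have mf : measurable_fun [set: Rn R n] f by case: fL.
have main := best_approx_integral_le Phi C1 HC mf pbest qm.
have mQ := measurable_peval (q - p).
have mN : measurable_fun [set: Rn R n] (fun t => `|peval (q - p) t|).
  exact: measurableT_comp.
have mfq := measurable_funB mf (measurable_peval q).
have drho0 : 0 <= d * (e / N) by rewrite mulr_ge0// ltW.
have [mS muS] := measurable_box_measure lo drho0.
have SB : box lo (d * (e / N)) `<=` B.
  by move=> t /boxQ[xt _]; exact: cube_sub_eball xt.
have M40 : 0 <= M / 4 by rewrite divr_ge0.
have low := ge0_integral_ge_cst (mulr_ge0 (rge0 (M / 4)) M40) mB mS SB muS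
  (measurable_funM (measurable_rderiv_norm Phi mQ) mN)
  (fun t => mulr_ge0 (rge0 _) (normr_ge0 _)) _.
have {}low := low (fun t St => ler_pM (rge0 _) M40
  (rderiv_homo Phi (boxQ (coord t) St).2) (boxQ (coord t) St).2).
(* The ball lies in the [N]-fold dilation of the inscribed cube, so the growth bound is taken with
   ratio [N^-1]. *)
have QB t : B t -> `|peval (q - p) t| <= G * M / (N^-1) ^+ m.
  move=> Bt; apply: HG QM _ _ => //.
    by rewrite invr_gt0 N0 invf_le1.
  by move=> i; rewrite mulrC ler_pM2r ?invr_gt0// eball_coord.
have GM0 : 0 <= G * M / (N^-1) ^+ m.
  by rewrite !mulr_ge0 ?invr_ge0 ?exprn_ge0 ?invr_ge0// ltW.
have up := ge0_integralM_le mu GM0 mB (measurable_rderiv_norm Phi mfq) mN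
  (fun t => rge0 _) (fun t => normr_ge0 _) QB.
have {main low up} := le_trans low (le_trans main (lee_wpmul2l _ up)).
rewrite jE lee_fin mulrn_wge0// => /(_ isT).
rewrite -!EFinM lee_fin exprVn invrK -[C *+ 2]mulr_natr => main.
have {}main :
    rderiv phi (M / 4) * (d * (e / N)) ^+ n <= C *+ 8 * G * N ^+ m * j.
  rewrite -(ler_pM2l Mgt0).
  have -> : M * (rderiv phi (M / 4) * (d * (e / N)) ^+ n) =
      4 * (rderiv phi (M / 4) * (M / 4) * (d * (e / N)) ^+ n).
    by set r := rderiv _ _; set D := (_ * _) ^+ n; field.
  have -> : M * (C *+ 8 * G * N ^+ m * j) = 4 * (C * 2 * (G * M * N ^+ m * j)).
    by set L := N ^+ m; ring.
  by rewrite ler_pM2l.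
have D0 : 0 < (d * (e / N)) ^+ n by rewrite exprn_gt0// mulr_gt0.
have eE : (e *+ 2) ^+ n = (2 * N / d) ^+ n * (d * (e / N)) ^+ n.
  rewrite -exprMn; congr (_ ^+ _); rewrite -mulr_natl.
  by field; rewrite !gt_eqF.
have jb : j = b * (b^-1 * j) by rewrite mulrA mulfV ?mul1r// gt_eqF.
rewrite -(ler_pM2r D0) (le_trans main)//.
apply: (@le_trans _ _ (K0 * (b^-1 * j) * (d * (e / N)) ^+ n)); last first.
  by rewrite ler_pM2r// ler_wpM2r// lerDr.
rewrite {1}jb /K0; set T := (_ / d) ^+ n in eE *; set D := (d * _) ^+ n in eE *.
have -> : C *+ 8 * G * N ^+ m * T * (b^-1 * j) * D =
    C *+ 8 * G * N ^+ m * ((e *+ 2) ^+ n * (b^-1 * j)) by rewrite eE; ring.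
by rewrite ler_wpM2l ?ler_wpM2r// !mulr_ge0 ?mulrn_wge0 ?exprn_ge0 ?(ltW N0).
Qed.

End sup_estimate.

(** * Passage to the limit *)

Lemma rderiv_doubling_iter (R : realType) (phi : R -> R) (C : R) k (s : R) :
  class_Phi phi -> 0 <= C ->
  (forall s, 0 <= s -> rderiv phi (2 * s) <= C * lderiv phi s) ->
  0 <= s -> rderiv phi (2 ^+ k * s) <= C ^+ k * rderiv phi s.
Proof.
move=> Phi C0 HC s0; elim: k => [|k IH]; first by rewrite !expr0 !mul1r.
rewrite !exprS -!mulrA; apply: le_trans (HC _ _) _.
  by rewrite mulr_ge0// exprn_ge0.
rewrite ler_wpM2l//; apply: le_trans IH; exact: lderiv_le_rderiv.
Qed.

Theorem proposition5p5 (R : realType) (n m : nat) (phi : R -> R)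
    (f : Rn R n -> R) (x : Rn R n)
    (Pe : R -> mpoly.mpoly n R) (Px : mpoly.mpoly n R) :
  class_Phi phi ->
  L_loc (rderiv phi) f ->
  {in `[0, +oo[ &, {homo rderiv phi : r s / r < s}} ->
  t_class (rderiv phi) m x f ->
  (forall e : R, 0 < e -> ext_best_approx phi m f x e (Pe e)) ->
  taylor_witness (rderiv phi) m f x Px ->
  forall t : Rn R n, peval (Pe e) t @[e --> 0^'+] --> peval Px t.
Proof.
move=> Phi fL _ _ best [Pxm /eqoP small] t.
have [C C1 HC] := rderiv_doubling Phi.
have C0 : 0 < C by apply: lt_le_trans C1.
have [K K0 HK] := @best_approx_sup_le R n phi m Phi.
have [G G0 HG] := @meval_growth R n m.
(* [V] dominates every coordinate of [t - x], so shrinking [t - x] by [sigma * e] brings it into the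
   cube of half side [e / n.+1%:R]. *)
pose V := 1 + \sum_i `|coord t i - coord x i|.
have V1 : 1 <= V by rewrite lerDl sumr_ge0.
pose sigma := (n.+1%:R * V)^-1.
have nV1 : 1 <= n.+1%:R * V by rewrite mulr_ege1// ler1n.
have nV0 : 0 < n.+1%:R * V by apply: lt_le_trans nV1.
have sigma0 : 0 < sigma by rewrite invr_gt0.
have sigma1 : sigma <= 1 by rewrite invf_le1.
apply/cvgrPdist_le => /= eta eta0.
(* If [M <= 4 * (e ^+ m / 2 ^+ k)], the growth bound [G * M / (sigma * e) ^+ m] is at most [eta] as
   soon as [A <= 2 ^+ k]; the powers of [e] cancel. *)
pose A := G * 4 / sigma ^+ m / eta.
have A0 : 0 <= A.
  by rewrite !mulr_ge0 ?invr_ge0 ?exprn_ge0 ?(ltW sigma0) ?(ltW eta0).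
have [k Ak] : exists k, A <= 2 ^+ k.
  exists (Num.bound A); apply/ltW/(lt_trans (archi_boundP A0)).
  by rewrite -natrX ltr_nat ltn_expl.
(* The little-o rate absorbs [K] and the [k] doublings and leaves a factor one half for the
   contradiction below. *)
have rate0 : 0 < (K * C ^+ k * 2)^-1.
  by rewrite invr_gt0 !mulr_gt0// exprn_gt0.
have {}small := small _ rate0.
near=> e.
have e0 : 0 < e by near: e; exact: nbhs_right_gt.
have e1 : e <= 1 by near: e; exact: nbhs_right_le.
have em0 : 0 < e ^+ m by rewrite exprn_gt0.
have rem0 := rderiv_gt0 Phi em0.
have [M [M0 QM rM]] := HK f x e (Pe e) Px fL e0 (best e e0) Pxm.
have mean_le : (fine (lebesgue_Rn (eball x e)))^-1 *
    \int[@lebesgue_Rn R n]_(t in eball x e) rderiv phi `|f t - peval Px t| <=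
    (K * C ^+ k * 2)^-1 * rderiv phi (e ^+ m).
  apply: (le_trans (ler_norm _)).
  rewrite -[X in _ <= _ * X]ger0_norm ?(ltW rem0)//.
  by near: e.
have Mle : M / 4 <= e ^+ m / 2 ^+ k.
  (* Otherwise [k] doublings, monotonicity, the supremum bound and the rate give [rderiv phi (e ^+
     m) <= rderiv phi (e ^+ m) / 2], although this value is positive. *)
  rewrite leNgt; apply/negP => Mgt.
  have s0 : 0 <= e ^+ m / 2 ^+ k by rewrite divr_ge0 ?exprn_ge0// ltW.
  have := rderiv_doubling_iter k Phi (ltW C0) HC s0.
  rewrite mulrC divfK ?expf_neq0// ?pnatr_eq0// => dbl.
  have Ck0 : 0 <= C ^+ k := exprn_ge0 k (ltW C0).
  have := le_trans dbl (ler_wpM2l Ck0 (rderiv_homo Phi (ltW Mgt))).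
  move=> /le_trans/(_ (ler_wpM2l Ck0 rM)).
  move=> /le_trans/(_ (ler_wpM2l Ck0 (ler_wpM2l (ltW K0) mean_le))).
  have -> : C ^+ k * (K * ((K * C ^+ k * 2)^-1 * rderiv phi (e ^+ m))) =
      rderiv phi (e ^+ m) / 2.
    by field; rewrite expf_neq0 ?gt_eqF.
  by rewrite ler_pdivlMr// mulr_natr mulr2n gerDl leNgt rem0.
rewrite -pevalB.
have re01 : 0 < sigma * e <= 1.
  by rewrite mulr_gt0//= mulr_ile1// ltW.
have Qt := HG (Px - Pe e) (coord x) (e / n.+1%:R) M (sigma * e) (coord t)
  (poly_spaceB (best e e0).1 Pxm) QM re01.
apply: le_trans (Qt _) _ => [i|].
  rewrite mulrAC mulrC ler_pM2l// /sigma invfM -mulrA ler_piMr ?invr_ge0//.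
  rewrite ler_pdivrMl ?(lt_le_trans ltr01 V1)// mulr1.
  by rewrite /V (bigD1 i)//= addrCA lerDl addr_ge0// sumr_ge0.
rewrite ler_pdivrMr ?exprn_gt0 ?mulr_gt0// exprMn.
have {}Mle : M <= 4 * (e ^+ m / 2 ^+ k) by rewrite mulrC -ler_pdivrMr.
apply: (le_trans (ler_wpM2l G0 Mle)).
have -> : G * (4 * (e ^+ m / 2 ^+ k)) = G * 4 / 2 ^+ k * e ^+ m by ring.
rewrite mulrA ler_pM2r// ler_pdivrMr ?exprn_gt0//.
move: Ak; rewrite /A ler_pdivrMr// ler_pdivrMr ?exprn_gt0// => /le_trans; apply.
by rewrite -mulrA mulrC.
Unshelve. all: by end_near. Qed.
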